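(* Let $N,M$ be integers with $3\leq M\leq N$. Then the directed graph $G(N,M)$ is weakly connected, and its strongly connected components are: one strongly connected component containing $M^N-M^{N-M+1}$ vertices, and $M^{N-M+1}$ strongly connected components each containing a single vertex of in-degree zero.
   Context: For a positive integer $K$ write $[K]=\{1,\ldots,K\}$. For integers $N\geq 1$, $M\geq 2$, let $V=\{f:[N]\to[M]\}$ be the set of all functions (called configurations of $N$ people in $M$ rooms) and let $E\subseteq V\times V$ be the set of pairs $(f,g)$ such that for all $k\in[N]$: $g(k)\neq f(k)$ if and only if $k=\max f^{-1}(f(k))$. (That is, exactly the largest-numbered person in each occupied room changes room.) Then $G(N,M)=(V,E)$ is a directed graph. A directed graph is weakly connected if its underlying undirected graph is connected. *)

(* Defs.v *)
From mathcomp Require Import all_boot.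
Set Implicit Arguments.
Unset Strict Implicit.
Unset Printing Implicit Defensive.

Definition weakly_connected (T : finType) (e : rel T) : Prop :=
  forall x y : T, connect (fun u v => e u v || e v u) x y.

Definition strongly_equiv (T : finType) (e : rel T) : rel T :=
  fun x y => connect e x y && connect e y x.

Definition strong_components (T : finType) (e : rel T) : {set {set T}} :=
  equivalence_partition (strongly_equiv e) [set: T].

Definition in_degree (T : finType) (e : rel T) (x : T) : nat :=
  #|[set y | e y x]|.

(* People and rooms are numbered from 0 instead of 1; only the order of the
   people matters. *)
Definition config (N M : nat) := {ffun 'I_N -> 'I_M}.

(* The maximum is taken in nat over a set containing k, so the default value 0
   of an empty maximum never occurs. *)
Definition G (N M : nat) : rel (config N M) :=
  fun f g => [forall k : 'I_N,
    (g k != f k) == (k == \max_(j in f @^-1: [set f k]) j :> nat)].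

(* Main.v *)
Require Import Defs.
From mathcomp Require Import all_boot all_fingroup.
Set Implicit Arguments.
Unset Strict Implicit.
Unset Printing Implicit Defensive.

(**
Write N = P + M and cut a configuration into a prefix (the rooms of the P
smallest people) and a tail (the rooms of the M largest people).  The order
makes the tail autonomous: whether one of the M largest people moves depends
on the tail alone, and the prefix can never hinder it.

A configuration whose tail is constant has no predecessor.  If its tail is
constantly r and a predecessor had some r in its tail, the largest person in r
would have had to leave r; so nobody of the tail was in r, everybody of the
tail moved, hence everybody was alone among the tail, and M people fill M - 1
rooms.  There are M ^ (P + 1) such configurations, and each is a strong
component on its own ([strong_components_sources]).

Every configuration f reaches every configuration g with nonconstant tail
([connect_glue_nonconstant]), in three stages that pass through full
configurations, those whose tail is a permutation of the rooms.

- f reaches a full configuration, because the image of the tail can be made to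
  grow as long as the tail is not injective ([G_grow]).
- g has a full predecessor, because a nonconstant map is avoided at every point
  by some permutation ([perm_avoiding]), and in a full configuration exactly
  the tail moves, each person freely.
- Full configurations reach one another ([glue_perm_connect]).  If the prefix is
  kept fixed, the permutation of the tail can be composed with any derangement.
  The derangements generate a normal subgroup that contains the 3-cycles, so it
  has index at most 2 (exactly 2 for M = 3).  The missing transposition comes
  with the moves of the prefix: to move its largest person in room c, let the
  tail vacate c for one step.  Two people t, m of the tail then share a room, so
  exchanging t and m beforehand makes no difference, and both cosets are merged
  ([room_move_two_sources]).  Thus moving the top person of one room of the
  prefix while changing the permutation arbitrarily is possible, and such moves
  connect all prefixes ([room_step_agree]).
*)

(** * The people who move *)

Definition top n M (f : {ffun 'I_n -> 'I_M}) (k : 'I_n) : bool :=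
  [forall j, (f j == f k) ==> (j <= k)].

Lemma topP n M (f : {ffun 'I_n -> 'I_M}) k :
  reflect (forall j, f j = f k -> j <= k) (top f k).
Proof.
apply: (iffP forallP) => [H j /eqP fj|H j]; first by have /implyP/(_ fj) := H j.
by apply/implyP => /eqP/H.
Qed.

Lemma G_top N M (f g : config N M) :
  G f g = [forall k, (g k != f k) == top f k].
Proof.
apply: eq_forallb => k; congr (_ == _).
apply/eqP/topP => [-> j fj|H].
  by apply: (leq_bigmax_cond (F := @nat_of_ord N)); rewrite !inE fj.
apply/eqP; rewrite eqn_leq; apply/andP; split.
  by apply: (leq_bigmax_cond (F := @nat_of_ord N)); rewrite !inE.
by apply/bigmax_leqP => j; rewrite !inE => /eqP/H.
Qed.

Lemma GP N M (f g : config N M) :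
  reflect (forall k, (g k != f k) = top f k) (G f g).
Proof.
rewrite G_top; apply: (iffP forallP) => H k; first exact: (eqP (H k)).
by rewrite H.
Qed.

Lemma top_exists n M (f : {ffun 'I_n -> 'I_M}) j :
  exists2 k, top f k & f k = f j.
Proof.
case: (@arg_maxnP _ j (fun k => f k == f j) (@nat_of_ord n) (eqxx _)) => k /eqP fk H.
by exists k => //; apply/topP => i; rewrite fk => fi; apply: H; rewrite fi eqxx.
Qed.

Lemma top_inj n M (f : {ffun 'I_n -> 'I_M}) :
  {in [set k | top f k] &, injective f}.
Proof.
move=> i j; rewrite !inE => /topP ti /topP tj e.
by apply/val_inj/eqP; rewrite eqn_leq tj // ti.
Qed.

Lemma top_perm M (s : {perm 'I_M}) j : top (finfun s) j.
Proof. by apply/topP => i; rewrite !ffunE => /perm_inj ->. Qed.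

(** * Permutations with forbidden values *)

(** Among the permutations [p] of [D], one with the fewest bad points (those
where [s0 (p i) = g i]) has none.  If [i] is bad, then [g i] is a value of [s0]
on [D], so there is some [j] in [D] with [g j != g i].  Exchange the values at
[i] and [j]: this cures [i], as [s0] is injective on [D], and leaves [j] not bad,
as its new value is [g i]. *)
Lemma perm_avoiding (T : finType) (U : eqType) (D : {set T}) (s0 g : T -> U) :
  {in D &, injective s0} ->
  (forall i, i \in D -> (forall j, j \in D -> s0 j != g i) \/
                        exists2 j, j \in D & g j != g i) ->
  exists2 p : {perm T}, perm_on D p & forall i, i \in D -> s0 (p i) != g i.
Proof.
move=> s0I Dg.
pose bad (p : {perm T}) := [set i in D | s0 (p i) == g i].
have [p0 p0D p0min] := @arg_minnP _ (1%g : {perm T}) (perm_on D)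
  (fun p => #|bad p|) (perm_on1 D).
exists p0 => // i iD; apply/negP => bi.
case: (Dg i iD) => [/(_ (p0 i))|[j jD gj]].
  by rewrite (perm_closed _ p0D) iD bi => /(_ isT).
have nij : i != j by apply: contraNneq gj => ->.
pose p1 := (tperm i j * p0)%g.
have p1D : perm_on D p1.
  apply: perm_onM => //; apply/subsetP => k; rewrite inE.
  by case: tpermP => [->|->|] //; rewrite eqxx.
have := p0min _ p1D; rewrite leqNgt => /negP; apply.
apply: proper_card; apply/properP; split; last first.
  exists i; rewrite !inE iD ?bi //= permM tpermL.
  rewrite -(eqP bi); apply: contra nij => /eqP/s0I.
  by rewrite !(perm_closed _ p0D) => /(_ jD iD)/perm_inj ->.
apply/subsetP => k; rewrite !inE permM => /andP[kD]; rewrite kD /=.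
case: tpermP => [-> /eqP e|-> /eqP e|//].
  case/eqP: nij; apply/esym; apply: (@perm_inj _ p0); apply: s0I.
  - by rewrite (perm_closed _ p0D).
  - by rewrite (perm_closed _ p0D).
  - by rewrite e (eqP bi).
by rewrite -e (eqP bi) eqxx in gj.
Qed.

(** * The group generated by the derangements *)

Section Derangements.
Variable T : finType.
Implicit Types (x y z : T) (d : {perm T}).

Definition derangements : {set {perm T}} :=
  [set d : {perm T} | [forall i, d i != i]].

Lemma derangementsP d : reflect (forall i, d i != i) (d \in derangements).
Proof. by rewrite inE; apply: forallP. Qed.

(** The 3-cycle [a] is a quotient of two derangements: if [d] is a derangement
with [d x = y] and [d y = z], then [a * d] is a derangement as well. *)
Lemma three_cycle_derangements x y z : x != y -> x != z -> y != z ->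
  (tperm x y * tperm x z)%g \in <<derangements>>%g.
Proof.
move=> xy xz yz; set a := (_ * _)%g.
have ax : a x = y by rewrite permM tpermL tpermD // eq_sym.
have ay : a y = z by rewrite permM tpermR tpermL.
have az : a z = x by rewrite permM (tpermD xz yz) tpermR.
have aD i : i != x -> i != y -> i != z -> a i = i.
  by move=> ix iy iz; rewrite permM [tperm x y i]tpermD 1?eq_sym // tpermD 1?eq_sym.
have [|i|p pD pP] := @perm_avoiding T T (~: [set x; y]) a id.
- by move=> i j _ _ /perm_inj.
- rewrite !inE negb_or => /andP[ix iy]; have [->|iz] := eqVneq i z.
    left => j; rewrite !inE negb_or => /andP[jx jy].
    by apply: contra jy => /eqP; rewrite -ay => /perm_inj ->.
  by right; exists z; rewrite 1?eq_sym // !inE !(eq_sym z) negb_or xz yz.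
pose d := (p * a)%g.
have dx : d x = y by rewrite permM (out_perm pD) // !inE eqxx.
have dy : d y = z by rewrite permM (out_perm pD) // !inE eqxx orbT.
have dd : d \in derangements.
  apply/derangementsP => i; have [->|ix] := eqVneq i x; first by rewrite dx eq_sym.
  have [->|iy] := eqVneq i y; first by rewrite dy eq_sym.
  by rewrite permM pP // !inE negb_or ix.
rewrite -(mulgK d a) groupM ?groupV ?mem_gen //.
apply/derangementsP => i; rewrite permM.
have [->|ix] := eqVneq i x; first by rewrite ax dy eq_sym.
have [->|iy] := eqVneq i y.
  by rewrite ay -[X in _ != X]dx (inj_eq perm_inj) eq_sym.
have [->|iz] := eqVneq i z; first by rewrite az dx.
by rewrite aD //; apply/derangementsP.
Qed.

(** The derangements generate a normal subgroup [K].  Modulo 3-cycles all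
transpositions [tperm x z] agree with [tperm x y], and they generate the
symmetric group, so [K] and one transposition generate everything. *)
Lemma perm_derangements_tperm x y (s : {perm T}) : x != y ->
  s \in <<derangements>>%g \/ (s * tperm x y)%g \in <<derangements>>%g.
Proof.
move=> xy; pose K := (<<derangements>>)%G; set t := tperm x y.
have nK : (<[t]> \subset 'N(K))%g.
  apply: (subset_trans (subsetT _)); apply: norms_gen.
  apply/subsetP => u _; rewrite inE; apply/subsetP => _ /imsetP[d /derangementsP dd ->].
  apply/derangementsP => i; rewrite -(permKV u i) permJ.
  by rewrite (inj_eq perm_inj).
have KT : (K * <[t]> = [set: {perm T}])%g.
  rewrite -norm_joinEr //; apply/eqP; rewrite eqEsubset subsetT /=.
  rewrite -(gen_tperm x) gen_subG; apply/subsetP => _ /imsetP[z _ ->].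
  have [<-|xz] := eqVneq x z; first by rewrite tperm1 group1.
  rewrite -[pred_of_set _]/(pred_of_set (K <*> <[t]>)%g) norm_joinEr //.
  have [->|yz] := eqVneq z y.
    by rewrite -[tperm _ _]mul1g mem_mulg ?group1 ?cycle_id.
  rewrite -(mulgK t (tperm x z)) tpermV mem_mulg ?cycle_id //.
  exact: three_cycle_derangements.
have : s \in (K * <[t]>)%g by rewrite KT inE.
case/mulsgP => k u kK /cycleP[n ->] ->.
rewrite -(odd_double_half n) expgD -muln2 mulnC expgM (expgS t 1) tperm2 expg1n mulg1.
case: (odd n); last by left; rewrite mulg1.
by right; rewrite expg1 -mulgA tperm2 mulg1.
Qed.

End Derangements.


Lemma perm_avoiding_nonconstant (T : finType) (g : T -> T) a b :
  g a != g b -> exists p : {perm T}, forall i, p i != g i.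
Proof.
move=> gab; have [//|i _|p _ pg] := @perm_avoiding T T [set: T] id g.
  have [ga|ga] := eqVneq (g a) (g i); last by right; exists a.
  by right; exists b; rewrite // -ga eq_sym.
by exists p => i; apply: pg.
Qed.

(** * Prefix and tail *)

Section Glue.
Variables P M : nat.
Implicit Types (x y : {ffun 'I_P -> 'I_M}) (h : {ffun 'I_M -> 'I_M}).
Implicit Types (s : {perm 'I_M}) (c : 'I_M).

Definition glue x h : config (P + M) M :=
  [ffun k => match split k with inl i => x i | inr j => h j end].

Lemma glueL x h i : glue x h (lshift M i) = x i.
Proof. by rewrite ffunE (unsplitK (inl i : 'I_P + 'I_M)). Qed.

Lemma glueR x h j : glue x h (rshift P j) = h j.
Proof. by rewrite ffunE (unsplitK (inr j : 'I_P + 'I_M)). Qed.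

Lemma glue_surj (f : config (P + M) M) : exists x h, f = glue x h.
Proof.
exists [ffun i => f (lshift M i)], [ffun j => f (rshift P j)].
by apply/ffunP => k; rewrite -(splitK k); case: (split k) => i;
  rewrite ?glueL ?glueR ffunE.
Qed.

Lemma top_glueL x h i :
  top (glue x h) (lshift M i) = [forall j, h j != x i] && top x i.
Proof.
apply/topP/andP => [H|[/forallP hx /topP xi] k].
  split; first (apply/forallP => j; apply/eqP => hj).
    have := H (rshift P j); rewrite glueR glueL => /(_ hj) /=.
    by rewrite leqNgt (leq_trans (ltn_ord i)) ?leq_addr.
  by apply/topP => i' xi; have := H (lshift M i'); rewrite !glueL => /(_ xi).
rewrite -(splitK k); case: (split k) => j; rewrite !(glueL, glueR); first exact: xi.
by move=> hj; have := hx j; rewrite hj eqxx.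
Qed.

Lemma top_glueR x h j : top (glue x h) (rshift P j) = top h j.
Proof.
apply/topP/topP => H k.
  by move=> hk; have := H (rshift P k); rewrite !glueR leq_add2l; apply.
rewrite -(splitK k); case: (split k) => i; rewrite !(glueL, glueR).
  by move=> _; rewrite /= (leq_trans (ltnW (ltn_ord i))) ?leq_addr.
by rewrite leq_add2l; apply: H.
Qed.

Lemma G_glue x y h h' :
  (forall i, (y i != x i) = [forall j, h j != x i] && top x i) ->
  G h h' -> G (glue x h) (glue y h').
Proof.
move=> xy /GP hh; apply/GP => k; rewrite -(splitK k); case: (split k) => i.
  by rewrite !glueL top_glueL.
by rewrite !glueR top_glueR.
Qed.

Lemma G_glueR x y h h' : G (glue x h) (glue y h') -> G h h'.
Proof.
by move=> /GP H; apply/GP => j; have := H (rshift P j); rewrite !glueR top_glueR.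
Qed.

(** The tail of a full configuration occupies every room, which keeps the prefix
in place, and all of its members are alone, which lets them all move. *)
Lemma G_glue_perm x s h' :
  (forall j, h' j != s j) -> G (glue x (finfun s)) (glue x h').
Proof.
move=> sh; apply: G_glue => [i|].
  rewrite eqxx; apply/esym/negbTE; rewrite negb_and; apply/orP; left.
  by apply/forallPn; exists (s^-1%g (x i)); rewrite ffunE permKV eqxx.
by apply/GP => j; rewrite top_perm ffunE sh.
Qed.

Lemma other_room c : 1 < M -> exists d, d != c.
Proof.
move=> M1; have [->|] := eqVneq c (Ordinal M1); last first.
  by exists (Ordinal M1); rewrite eq_sym.
by exists (Ordinal (ltnW M1)).
Qed.

(** Every walk of the tail alone lifts to a walk of all people: those of the
prefix who have to move can choose any other room. *)
Lemma G_glue_lift x h h' : 1 < M -> G h h' -> exists y, G (glue x h) (glue y h').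
Proof.
move=> M1 hh.
exists [ffun i => if [forall j, h j != x i] && top x i
                  then odflt (x i) [pick d | d != x i] else x i].
apply: G_glue hh => i; rewrite ffunE; case: ifP => _; last by rewrite eqxx.
case: pickP => [d ->//|/= no]; have [d] := other_room (x i) M1.
by rewrite no.
Qed.

(** * Moves between full configurations *)

Lemma connect_derangements x s (d : {perm 'I_M}) :
  d \in <<derangements 'I_M>>%g ->
  connect (@G _ _) (glue x (finfun s)) (glue x (finfun (d * s)%g)).
Proof.
pose A := [set d : {perm 'I_M} | [forall s : {perm 'I_M},
  connect (@G _ _) (glue x (finfun s)) (glue x (finfun (d * s)%g))]].
have gA : group_set A.
  apply/group_setP; split=> [|a b]; rewrite !inE.
    by apply/forallP => u; rewrite mul1g connect0.
  move=> /forallP Aa /forallP Ab; apply/forallP => u.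
  by rewrite -mulgA; apply: connect_trans (Ab u) (Aa _).
have dA : (<<derangements 'I_M>> \subset Group gA)%g.
  rewrite gen_subG; apply/subsetP => a /derangementsP ad.
  rewrite inE; apply/forallP => u; apply/connect1/G_glue_perm => j.
  by rewrite ffunE permM (inj_eq perm_inj).
by move/(subsetP dA); rewrite inE => /forallP.
Qed.

(** The largest person of room [c] goes to some other room and nobody else moves;
in particular [y = x] if room [c] is empty. *)
Definition room_move c x y :=
  forall i, (y i != x i) = (x i == c) && top x i.

Lemma two_others (u : 'I_M) : 2 < M ->
  exists t m : 'I_M, [/\ t < m, t != u & m != u].
Proof.
move=> M2; pose o k (kM : k < 3) : 'I_M := Ordinal (leq_trans kM M2).
have [u0|u0] := eqVneq (u : nat) 0.
  by exists (@o 1 isT), (@o 2 isT); split; rewrite // -val_eqE /= u0.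
have [u1|u1] := eqVneq (u : nat) 1.
  by exists (@o 0 isT), (@o 2 isT); split; rewrite // -val_eqE /= u1.
by exists (@o 0 isT), (@o 1 isT); split; rewrite // -val_eqE /= eq_sym.
Qed.

(** The step before [s'] is a tail [h] that omits [c] and puts [t < m] in one
common room, everybody else being alone: then all of the tail but [t] move, and
so does the top of room [c] in the prefix.  As [h t = h m], a permutation that
avoids [h] still does so after [t] and [m] are exchanged, and such permutations
are predecessors of [h].  The freedom to exchange [t] and [m] is what changes the
parity when [M = 3]. *)
Lemma room_move_two_sources c x y (s' : {perm 'I_M}) : 2 < M -> room_move c x y ->
  exists t m : 'I_M, exists s : {perm 'I_M},
  [/\ t != m,
      connect (@G _ _) (glue x (finfun s)) (glue y (finfun s')) &
      connect (@G _ _) (glue x (finfun (tperm t m * s)%g)) (glue y (finfun s'))].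
Proof.
move=> M2 xy; (* [u] must enter [c] in the second step, while [t] stays and [m] leaves the
   room of [t]; hence both differ from [u]. *)
pose u := (s'^-1 c)%g.
have s'u : s' u = c by rewrite permKV.
have [t [m [tm tu mu]]] := two_others u M2.
have ntm : t != m by apply: contraTneq tm => ->; rewrite ltnn.
(* [h] is first built as a permutation [q] that puts [m] in [c]; [m] is moved to
   the room of [t] afterwards. *)
pose s0 := (tperm u m * s')%g.
have s0m : s0 m = c by rewrite permM tpermR.
have s0t : s0 t = s' t by rewrite permM tpermD // eq_sym.
have [|i iD|p pD pP] := @perm_avoiding _ _ (~: [set t; m]) s0 s'.
- by move=> i j _ _ /perm_inj.
- have [->|iu] := eqVneq i u.
    left=> j; rewrite !inE negb_or => /andP[_].
    by apply: contra; rewrite s'u -s0m (inj_eq perm_inj).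
  right; exists u; first by rewrite !inE negb_or ![u == _]eq_sym tu.
  by rewrite (inj_eq perm_inj) eq_sym.
pose q := (p * s0)%g.
have qt : q t = s' t by rewrite permM (out_perm pD) // !inE eqxx.
have qm : q m = c by rewrite permM (out_perm pD) // !inE eqxx orbT.
pose h : {ffun 'I_M -> 'I_M} := [ffun j => if j == m then s' t else q j].
have hm : h m = s' t by rewrite ffunE eqxx.
have hq j : j != m -> h j = q j by move=> jm; rewrite ffunE (negbTE jm).
have ht : h t = s' t by rewrite hq.
have hc j : h j != c.
  rewrite ffunE; case: ifP => [_|jm]; first by rewrite -s'u (inj_eq perm_inj).
  by rewrite -qm (inj_eq perm_inj) jm.
have toph j : top h j = (j != t).
  have [->|jt] := eqVneq j t.
    by apply/negP => /topP/(_ m); rewrite ht hm => /(_ erefl); rewrite leqNgt tm.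
  apply/topP => k; have [->|km] := eqVneq k m; have [->|jm] := eqVneq j m => //.
  - by rewrite hm (hq j) // -qt => /perm_inj e; rewrite e eqxx in jt.
  - by rewrite hm (hq k) // -qt => /perm_inj ->; apply: ltnW.
  - by rewrite !hq // => /perm_inj ->.
have hs' : G h (finfun s').
  apply/GP => j; rewrite toph ffunE; have [->|jt] := eqVneq j t.
    by rewrite ht eqxx.
  have [->|jm] := eqVneq j m; first by rewrite hm (inj_eq perm_inj) eq_sym.
  by rewrite hq // eq_sym permM pP // !inE negb_or jt.
have step2 : G (glue x h) (glue y (finfun s')).
  apply: G_glue hs' => i; rewrite xy; congr (_ && _).
  apply/eqP/forallP => [-> //|hx]; apply/eqP; apply: contraT => xc.
  have := hx (q^-1 (x i))%g; rewrite hq ?permKV ?eqxx //.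
  by apply: contra xc => /eqP e; rewrite -qm -e permKV.
have [|s sP] := @perm_avoiding_nonconstant _ h t u.
  by rewrite ht (hq u) 1?eq_sym // -qt (inj_eq perm_inj) // eq_sym.
exists t, m, s; split=> //; apply: connect_trans (connect1 step2);
  apply/connect1/G_glue_perm => j; first by rewrite eq_sym.
suff -> : h j = h (tperm t m j) by rewrite permM eq_sym.
by case: tpermP => [->|->|//]; rewrite hm ht.
Qed.

(** Composing with derangements while the prefix is fixed leads from any [s] to
one of the two sources that [room_move_two_sources] provides, since these differ
by a transposition. *)
Lemma room_move_connect c x y s s' : 2 < M -> room_move c x y ->
  connect (@G _ _) (glue x (finfun s)) (glue y (finfun s')).
Proof.
move=> M2 /(room_move_two_sources s' M2)[t [m [s1 [tm c1 c2]]]].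
have [K1|K2] := perm_derangements_tperm (s * s1^-1)%g tm.
  apply: connect_trans c1; rewrite -(mulgKV s s1).
  by apply: connect_derangements; rewrite -groupV invMg invgK.
apply: connect_trans c2; rewrite -(mulgKV s (tperm t m * s1)%g).
by apply: connect_derangements; rewrite -groupV !invMg tpermV invgK mulgA.
Qed.

Definition room_step : rel {ffun 'I_P -> 'I_M} :=
  fun x y => [exists c, [forall i, (y i != x i) == (x i == c) && top x i]].

Lemma room_stepP x y : reflect (exists c, room_move c x y) (room_step x y).
Proof.
apply: (iffP existsP) => -[c xy]; exists c; last by apply/forallP => i; rewrite xy.
by move=> i; exact: (eqP (forallP xy i)).
Qed.

(** Induction on the number [k] of largest people who may disagree.  To correct
the smallest of them, [p], gather everybody above [p] in the target room [y p],
so that [p] is the top of its room, move [p], and correct the others. *)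
Lemma room_step_agree k x y : (forall i : 'I_P, i + k < P -> x i = y i) ->
  connect room_step x y.
Proof.
elim: k x y => [|k IH] x y xy.
  suff -> : x = y by exact: connect0.
  by apply/ffunP => i; apply: xy; rewrite addn0.
have [Pk|kP] := leqP P k.
  by apply: IH => i ik; apply: xy; rewrite ltnNge (leq_trans Pk) ?leq_addl in ik.
have pP : P - k.+1 < P by rewrite ltn_subrL (leq_trans _ kP).
pose p := Ordinal pP.
have pk i : (i + k < P) = (i <= p) by rewrite /= leq_subRL // addnC.
have pk1 i : (i + k.+1 < P) = (i < p) by rewrite /= ltn_subRL addnC.
have [xyp|xyp] := eqVneq (x p) (y p).
  apply: IH => i; rewrite pk leq_eqVlt => /predU1P[ip|ip]; last by rewrite xy ?pk1.
  by have -> : i = p by apply: val_inj.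
pose x1 := [ffun i : 'I_P => if i <= p then x i else y p].
pose x2 := [ffun i : 'I_P => if i < p then x i else y p].
apply: (@connect_trans _ _ x1).
  by apply: IH => i; rewrite pk ffunE => ->.
apply: (@connect_trans _ _ x2); last first.
  apply: IH => i; rewrite pk leq_eqVlt => /predU1P[ip|ip]; rewrite ffunE.
    by rewrite (val_inj ip : i = p) ltnn.
  by rewrite ip xy ?pk1.
apply/connect1/room_stepP; exists (x p) => i.
have x1p : x1 p = x p by rewrite ffunE leqnn.
rewrite [x1 i]ffunE ffunE; case: (ltngtP i p) => [ip|pi|/val_inj ->].
- rewrite eqxx; apply/esym/negbTE/andP => -[/eqP xip /topP/(_ p)].
  by rewrite x1p ffunE (ltnW ip) xip => /(_ erefl); rewrite leqNgt ip.
- by rewrite eqxx eq_sym (negbTE xyp).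
rewrite eq_sym xyp eqxx; apply/esym/topP => j.
by rewrite x1p ffunE; case: leqP => // _ e; rewrite e eqxx in xyp.
Qed.

Lemma room_step_connect x y : connect room_step x y.
Proof. by apply: (@room_step_agree P) => i; rewrite ltnNge leq_addl. Qed.

(** The first move from [x] to [z] is there because a path of length 0 from [x]
would leave the permutation unchanged. *)
Lemma glue_perm_connect x y s s' : 2 < M ->
  connect (@G _ _) (glue x (finfun s)) (glue y (finfun s')).
Proof.
move=> M2; pose c0 := Ordinal (ltnW (ltnW M2)).
have [z xz] : exists z, room_move c0 x z.
  have [d dc] := other_room c0 (ltnW M2).
  exists [ffun i => if (x i == c0) && top x i then d else x i] => i.
  by rewrite ffunE; case: ifP => [/andP[/eqP -> _] //|_]; rewrite eqxx.
have /connectP[p zp ->] := room_step_connect z y.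
elim: p x z c0 s xz zp => [|w p IH] x0 z0 c0 s0 xz0 /=.
  by move=> _; apply: room_move_connect xz0.
move=> /andP[/room_stepP[c zw] wp].
by apply: connect_trans (IH _ _ _ 1%g zw wp); apply: room_move_connect xz0.
Qed.

(** * Reaching a full configuration *)

(** As [h] is not injective, some [t] stays and some room [c] is empty.  Let the
movers permute their rooms, each leaving its own, with [c] in place of [h t].
The room [h t] is still occupied by [t], so no room is lost and [c] is gained. *)
Lemma G_grow h : ~~ injectiveb h ->
  exists2 h', G h h' & h @: [set: 'I_M] \proper h' @: [set: 'I_M].
Proof.
move=> nI.
have [c /forallP hc] : exists c, [forall j, h j != c].
  apply/existsP; apply: contraR nI => /existsPn onto.
  have hT : h @: [set: 'I_M] = [set: 'I_M].
    apply/setP => c; rewrite inE; have /forallPn[j] := onto c.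
    by rewrite negbK => /eqP <-; rewrite imset_f.
  apply/injectiveP => i j; have /imset_injP hI : #|h @: [set: 'I_M]| == #|[set: 'I_M]|.
    by rewrite hT.
  by apply: hI; rewrite inE.
have [t tt] : exists t, ~~ top h t.
  apply/existsP; apply: contraR nI => /existsPn allt.
  apply/injectiveP => i j; apply: (@top_inj _ _ h); rewrite inE.
    by have := allt i; rewrite negbK.
  by have := allt j; rewrite negbK.
pose D := [set j | top h j]; pose s0 j := tperm (h t) c (h j).
have s0r i : h i != h t -> s0 i = h i by move=> hi; rewrite /s0 tpermD // eq_sym.
have s0t i : h i = h t -> s0 i = c by move=> hi; rewrite /s0 hi tpermL.
have [|i iD|p pD pP] := @perm_avoiding _ _ D s0 h.
- by move=> i j iD jD /perm_inj; apply: top_inj.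
- have [hi|hi] := eqVneq (h i) (h t).
    left=> j _; have [hj|hj] := eqVneq (h j) (h t).
      by rewrite s0t // eq_sym.
    by rewrite s0r // hi.
  right; have [j jD hj] := top_exists h t; exists j; first by rewrite inE.
  by rewrite hj eq_sym.
pose h' := [ffun j => if top h j then s0 (p j) else h j].
have im' j : j \in D -> s0 j \in h' @: [set: 'I_M].
  move=> jD; apply/imsetP; exists (p^-1 j)%g; rewrite // ffunE permKV.
  have : (p^-1 j)%g \in D by rewrite -(perm_closed _ pD) permKV.
  by rewrite inE => ->.
exists h'.
  apply/GP => j; rewrite ffunE; case: ifP => [tj|_]; last by rewrite eqxx.
  by apply: pP; rewrite inE.
apply/properP; split.
  apply/subsetP => _ /imsetP[i _ ->]; have [j tj <-] := top_exists h i.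
  have [e|hj] := eqVneq (h j) (h t).
    by rewrite e; apply/imsetP; exists t; rewrite // ffunE (negbTE tt).
  by rewrite -s0r // im' // inE.
have [j tj hj] := top_exists h t.
exists c; first by rewrite -(s0t j) // im' // inE.
by apply/imsetP => -[i _ ci]; have := hc i; rewrite ci eqxx.
Qed.

Lemma reach_glue_perm x h : 1 < M ->
  exists y s, connect (@G _ _) (glue x h) (glue y (finfun s)).
Proof.
move=> M1; have [n] := ubnP (M - #|h @: [set: 'I_M]|).
elim: n x h => // n IH x h hn.
have [/injectiveP hI|/G_grow[h' hh' im]] := boolP (injectiveb h).
  exists x, (perm hI); suff -> : finfun (perm hI) = h by exact: connect0.
  by apply/ffunP => j; rewrite ffunE permE.
have [x' xx'] := G_glue_lift x M1 hh'.
have [|y [s hs]] := IH x' h'; last first.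
  by exists y, s; apply: connect_trans (connect1 xx') hs.
have := proper_card im; have := max_card (mem (h' @: [set: 'I_M])).
rewrite card_ord => le lt; apply: leq_trans (ltnSE hn).
by rewrite ltn_sub2l // (leq_trans lt).
Qed.

(** * Constant and nonconstant tails *)

Lemma connect_glue_nonconstant f x h a b : 2 < M -> h a != h b ->
  connect (@G _ _) f (glue x h).
Proof.
move=> M2 hab; have [p ph] := perm_avoiding_nonconstant hab.
have [x0 [h0 ->]] := glue_surj f.
have [y [s hs]] := reach_glue_perm x0 h0 (ltnW M2).
apply: connect_trans hs _; apply: connect_trans (glue_perm_connect y x s p M2) _.
by apply/connect1/G_glue_perm => j; rewrite eq_sym.
Qed.

Lemma no_predecessor_constant f x c : ~~ G f (glue x [ffun=> c]).
Proof.
have [x0 [h ->]] := glue_surj f; apply/negP => /G_glueR/GP H.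
have hc j : h j != c.
  apply/eqP => hj; have [k tk hk] := top_exists h j.
  by have := H k; rewrite tk ffunE hk hj eqxx.
have hI : injective h.
  by move=> i j; apply: (@top_inj _ _ h); rewrite inE -H ffunE eq_sym.
by have := hc ((perm hI)^-1 c)%g; rewrite -[h _](permE hI) permKV eqxx.
Qed.

(** The configurations that turn out to have no predecessor. *)
Definition last_together : {set config (P + M) M} :=
  [set glue u.1 [ffun=> u.2] | u : {ffun 'I_P -> 'I_M} * 'I_M].

Lemma card_last_together : 0 < M -> #|last_together| = M ^ (P + 1).
Proof.
move=> M0; rewrite card_imset ?card_prod ?card_ffun ?card_ord ?addn1 ?expnSr //.
move=> [x c] [y d] /= /ffunP e; congr (_, _).
  by apply/ffunP => i; have := e (lshift M i); rewrite !glueL.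
by have := e (rshift P (Ordinal M0)); rewrite !glueR !ffunE.
Qed.

Lemma last_togetherPn x h : 0 < M ->
  reflect (exists a b, h a != h b) (glue x h \notin last_together).
Proof.
move=> M0; apply: (iffP idP) => [|[a [b]]].
  have [j hj _|/= no /imsetP[]] := pickP (fun j => h j != h (Ordinal M0)).
    by exists j, (Ordinal M0).
  exists (x, h (Ordinal M0)) => //=; congr glue.
  by apply/ffunP => j; rewrite ffunE; apply/eqP/negbFE/no.
apply: contra => /imsetP[[y c] _ /= /ffunP e].
have hc j : h j = c by have := e (rshift P j); rewrite !glueR ffunE.
by rewrite !hc.
Qed.

End Glue.

(** * Strong components of a graph with sources *)

Section Sources.
Variables (T : finType) (e : rel T) (Z : {set T}).
Hypothesis source : forall z y, z \in Z -> ~~ e y z.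
Hypothesis reach : forall x y, y \notin Z -> connect e x y.

Lemma connect_source z y : z \in Z -> connect e y z -> y = z.
Proof.
move=> zZ /connectP[p]; case/lastP: p => [|p w] //=.
rewrite rcons_path last_rcons => /andP[_ we] zw; rewrite -zw in we.
by have := source (last y p) zZ; rewrite we.
Qed.

Lemma strong_components_sources : ~: Z != set0 ->
  strong_components e = ~: Z |: [set [set z] | z in Z].
Proof.
have clsZ x : x \in Z -> [set y in [set: T] | strongly_equiv e x y] = [set x].
  move=> xZ; apply/setP => y; rewrite !inE /strongly_equiv /=.
  apply/andP/eqP => [[_ /(connect_source xZ)]//|->].
  by rewrite connect0.
have clsC x : x \notin Z -> [set y in [set: T] | strongly_equiv e x y] = ~: Z.
  move=> xZ; apply/setP => y; rewrite !inE /strongly_equiv /=.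
  apply/andP/idP => [[xy _]|yZ]; last by rewrite !reach.
  by apply: contraNN xZ => yZ; rewrite (connect_source yZ xy).
case/set0Pn => c; rewrite inE => cZ; apply/setP => D; rewrite in_setU1.
apply/imsetP/orP => [[x _ ->]|[/eqP ->|/imsetP[z zZ ->]]].
- have [xZ|xZ] := boolP (x \in Z); last by left; rewrite clsC.
  by right; rewrite clsZ // imset_f.
- by exists c; rewrite ?clsC.
- by exists z; rewrite ?clsZ.
Qed.

Lemma strong_components_sources_setD1 : ~: Z != set0 ->
  strong_components e :\ ~: Z = [set [set z] | z in Z].
Proof.
move=> ZT; rewrite strong_components_sources // setU1K //.
apply/imsetP => -[z zZ /setP/(_ z)]; by rewrite !inE eqxx zZ.
Qed.

End Sources.

(** * The components of the graph of configurations *)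

Theorem theorem1p2 (N M : nat) (hM : 3 <= M) (hMN : M <= N) :
  weakly_connected (@G N M) /\
  exists C : {set config N M},
    [/\ C \in strong_components (@G N M),
        #|C| = M ^ N - M ^ (N - M + 1),
        #|strong_components (@G N M) :\ C| = M ^ (N - M + 1) &
        forall D : {set config N M}, D \in strong_components (@G N M) :\ C ->
          exists2 f : config N M, D = [set f] & in_degree (@G N M) f = 0].
Proof.
have [P NE] : exists P, N = P + M by exists (N - M); rewrite subnK.
subst N; rewrite addnK.
have M0 : 0 < M by apply: leq_trans hM.
pose Z := last_together P M.
have source z f : z \in Z -> ~~ @G (P + M) M f z.
  by case/imsetP => -[x c] _ ->; apply: no_predecessor_constant.
have reach f g : g \notin Z -> connect (@G (P + M) M) f g.
  have [x [h ->]] := glue_surj g => /(last_togetherPn _ _ M0)[a [b hab]].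
  exact: connect_glue_nonconstant hab.
pose c := @glue P M [ffun=> Ordinal M0] [ffun j => j].
have cZ : c \notin Z.
  apply/last_togetherPn => //; exists (Ordinal M0), (Ordinal (ltnW hM)).
  by rewrite !ffunE.
have CZ : ~: Z != set0 by apply/set0Pn; exists c; rewrite inE.
split.
  pose w := fun u v : config (P + M) M => G u v || G v u.
  have wc f : connect w f c.
    by apply: connect_sub (reach f c cZ) => u v uv; rewrite connect1 // /w uv.
  have ws : connect_sym w by apply: sym_connect_sym => u v; rewrite /w orbC.
  by move=> f g; apply: connect_trans (wc f) _; rewrite ws.
exists (~: Z); rewrite strong_components_sources_setD1 //; split.
- by rewrite (strong_components_sources source reach) // setU11.
- by rewrite cardsCs setCK card_last_together // card_ffun !card_ord.
- by rewrite card_imset ?card_last_together //; apply: set1_inj.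
- move=> D /imsetP[z zZ ->]; exists z => //.
  by apply: eq_card0 => y; rewrite inE; apply/negbTE/source.
Qed.
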